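(* Every $\omega$-categorical ring $R$ whose theory does not have the strict order property is nilpotent-by-finite.
   Context: A structure in a countable language is $\omega$-categorical if its complete theory has, up to isomorphism, exactly one countable model. Rings are associative, not necessarily unital or commutative. A ring is nilpotent-by-finite if it has an ideal $I$ of finite index which is nilpotent, i.e. $r_1\cdots r_n=0$ for all $r_1,\dots,r_n\in I$, for some $n$. *)

(* Defs.v *)
From HB Require Import structures.
From mathcomp Require Import all_boot all_algebra.
From mathcomp Require Import boolp classical_sets cardinality.

Set Implicit Arguments.
Unset Strict Implicit.
Unset Printing Implicit Defensive.

Import GRing.Theory.
Local Open Scope classical_set_scope.
Local Open Scope ring_scope.

Record language := Language {
  fun_sym : Type;
  fun_arity : fun_sym -> nat;
  rel_sym : Type;
  rel_arity : rel_sym -> nat }.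

Record structure (L : language) := Structure {
  carrier :> Type;
  fun_interp : forall f : fun_sym L, ('I_(fun_arity f) -> carrier) -> carrier;
  rel_interp : forall r : rel_sym L, ('I_(rel_arity r) -> carrier) -> Prop }.

(* V is the type of free variables. *)
Inductive term (L : language) (V : Type) : Type :=
| Var of V
| App (f : fun_sym L) of ('I_(fun_arity f) -> term L V).

(* The body of a quantifier has one more free variable, namely None. The
   semantics below is classical, so that falsity, implication and universal
   quantification express all the other connectives. *)
Inductive formula (L : language) (V : Type) : Type :=
| Falsum
| Equal of term L V & term L V
| Rel (r : rel_sym L) of ('I_(rel_arity r) -> term L V)
| Implies of formula L V & formula L V
| Forall of formula L (option V).

Definition sentence (L : language) := formula L void.

Fixpoint eval (L : language) (M : structure L) (V : Type) (v : V -> M)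
    (t : term L V) : M :=
  match t with
  | Var x => v x
  | App f a => fun_interp (fun i => eval v (a i))
  end.

Fixpoint sat (L : language) (M : structure L) (V : Type) (v : V -> M)
    (p : formula L V) : Prop :=
  match p with
  | Falsum => False
  | Equal t u => eval v t = eval v u
  | Rel r a => rel_interp (fun i => eval v (a i))
  | Implies p q => sat v p -> sat v q
  | Forall p => forall x : M, sat (oapp v x) p
  end.

Definition models (L : language) (M : structure L) (T : set (sentence L)) :=
  forall s : sentence L, T s -> sat (of_void M) s.

Definition complete_theory (L : language) (M : structure L) : set (sentence L) :=
  [set s | sat (of_void M) s].

Definition isomorphic (L : language) (M N : structure L) : Prop :=
  exists f : M -> N,
    [/\ bijective f,
        forall (g : fun_sym L) (a : 'I_(fun_arity g) -> M),
          f (fun_interp a) = fun_interp (f \o a)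
      & forall (r : rel_sym L) (a : 'I_(rel_arity r) -> M),
          rel_interp a <-> rel_interp (f \o a)].

(* "Countable" includes "finite": finite structures are omega-categorical. *)
Definition omega_categorical (L : language) (M : structure L) : Prop :=
  exists N : structure L,
    [/\ countable [set: N],
        models N (complete_theory M)
      & forall N' : structure L, countable [set: N'] ->
          models N' (complete_theory M) -> isomorphic N N'].

(* The set p(M, b) for a formula p(x, y), with x = (x_0, ..., x_(m-1)) and
   y = (y_0, ..., y_(n-1)), and a tuple b of parameters. *)
Definition definable_set (L : language) (M : structure L) (m n : nat)
    (p : formula L ('I_m + 'I_n)) (b : 'I_n -> M) : set ('I_m -> M) :=
  [set a | sat (fun z => match z with inl i => a i | inr j => b j end) p].

Definition strict_order_property (L : language) (T : set (sentence L)) : Prop :=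
  exists M : structure L, models M T /\
    exists (m n : nat) (p : formula L ('I_m + 'I_n)) (b : nat -> 'I_n -> M),
      forall i : nat, definable_set p (b i) `<` definable_set p (b i.+1).

HB.mixin Record Zmodule_isRng R of GRing.Zmodule R := {
  rngmul : R -> R -> R;
  rngmulA : associative rngmul;
  rngmulDl : left_distributive rngmul +%R;
  rngmulDr : right_distributive rngmul +%R }.

(* Associative rings, not necessarily unital or commutative. *)
#[short(type="rngType")]
HB.structure Definition Rng := { R of Zmodule_isRng R & GRing.Zmodule R }.

Variant ring_sym := RingZero | RingAdd | RingOpp | RingMul.

Definition ring_arity (f : ring_sym) : nat :=
  match f with RingZero => 0 | RingAdd => 2 | RingOpp => 1 | RingMul => 2 end.

Definition ring_language : language :=
  Language ring_arity (of_void nat).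

Definition ring_fun_interp (R : rngType) (f : ring_sym) :
    ('I_(ring_arity f) -> R) -> R :=
  match f with
  | RingZero => fun=> 0
  | RingAdd => fun a => a ord0 + a ord_max
  | RingOpp => fun a => - a ord0
  | RingMul => fun a => rngmul (a ord0) (a ord_max)
  end.

Definition ring_structure (R : rngType) : structure ring_language :=
  @Structure ring_language R (@ring_fun_interp R)
    (fun r : void => match r with end).

Definition two_sided_ideal (R : rngType) (I : set R) : Prop :=
  [/\ I 0,
      forall x y : R, I x -> I y -> I (x - y)
    & forall r x : R, I x -> I (rngmul r x) /\ I (rngmul x r)].

Definition finite_index (R : rngType) (I : set R) : Prop :=
  finite_set (range (fun x : R => [set y : R | I (y - x)])).

(* The product r 0 * r 1 * ... * r n, with n.+1 factors. *)
Fixpoint rngprod (R : rngType) (r : nat -> R) (n : nat) : R :=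
  if n is k.+1 then rngmul (rngprod r k) (r k.+1) else r 0.

Definition nilpotent_set (R : rngType) (I : set R) : Prop :=
  exists n : nat, forall r : nat -> R,
    (forall i : nat, (i <= n)%N -> I (r i)) -> rngprod r n = 0.

Definition nilpotent_by_finite (R : rngType) : Prop :=
  exists I : set R, [/\ two_sided_ideal I, finite_index I & nilpotent_set I].

(* Main.v *)
(* By the Ryll-Nardzewski theorem, an omega-categorical ring R has only finitely
   many 0-definable subsets of R^n, for each n.  Applied to the graphs of the maps
   x |-> x^k this gives a uniform identity x^i = x^j, so that a fixed power of every
   element is idempotent.  Applied to the sets of elements b that start a strict
   chain of length k for inclusion of the sets {b} U Rb, it turns chains of
   arbitrary finite length into an infinite chain; hence under NSOP the length of
   such chains is bounded.

   The rest is algebra.  If L is a nil left ideal and s_1 ... s_k <> 0 with all s_i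
   in L, then the products s_i ... s_k form a strict chain; hence nil left ideals
   are nilpotent, in particular the radical J = {x | Rx is nil}, which is an ideal.
   The quotient Q = R/J has no nonzero nil left ideal, and a maximal idempotent of
   Q is a unit element.  If Q were infinite, then so would be Qe for a primitive
   idempotent e, then fQe for a primitive idempotent f, and finally the division
   ring fQf, in which x^m = 1 for all x <> 0.  But in such a division ring the
   centralizer of an element of an infinite subring K is infinite in K, which
   yields more than m + 1 commuting roots of X^(m+1) - X. *)

From HB Require Import structures.
From mathcomp Require Import all_boot all_algebra.
From mathcomp Require Import boolp classical_sets cardinality filter.
Require Import Defs.

Set Implicit Arguments.
Unset Strict Implicit.
Unset Printing Implicit Defensive.

Import GRing.Theory.
Local Open Scope classical_set_scope.

(** * Definable sets *)

Section Renaming.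
Variable L : language.

Fixpoint term_rename V W (g : V -> W) (t : term L V) : term L W :=
  match t with
  | Var x => Var L (g x)
  | App f a => App (fun i => term_rename g (a i))
  end.

Fixpoint formula_rename V W (g : V -> W) (p : formula L V) : formula L W :=
  match p with
  | Falsum => Falsum L W
  | Equal t u => Equal (term_rename g t) (term_rename g u)
  | Rel r a => Rel (fun i => term_rename g (a i))
  | Implies p q => Implies (formula_rename g p) (formula_rename g q)
  | Forall p => Forall (formula_rename (omap g) p)
  end.

Lemma eval_rename (M : structure L) V W (g : V -> W) (v : W -> M) t :
  eval v (term_rename g t) = eval (v \o g) t.
Proof. by elim: t => //= f a IH; congr fun_interp; apply/funext. Qed.

Lemma sat_rename (M : structure L) V W (g : V -> W) (v : W -> M) p :
  sat v (formula_rename g p) <-> sat (v \o g) p.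
Proof.
elim: p W g v => //= {V}.
- by move=> V t u W g v; rewrite !eval_rename.
- move=> V r a W g v; suff -> : (fun i => eval v (term_rename g (a i))) =
    (fun i => eval (v \o g) (a i)) by [].
  by apply/funext => i; rewrite eval_rename.
- by move=> V p IHp q IHq W g v; rewrite (IHp W g v) (IHq W g v).
- move=> V p IH W g v.
  have E x : oapp v x \o omap g = oapp (v \o g) x by apply/funext; case.
  by split=> H x; [rewrite -E; apply/IH|apply/IH; rewrite E]; exact: H.
Qed.

End Renaming.

(** * Truth is invariant under isomorphism *)

Section Isomorphism.
Variables (L : language) (M N : structure L) (f : M -> N).
Hypothesis f_bij : bijective f.
Hypothesis f_fun : forall (g : fun_sym L) (a : 'I_(fun_arity g) -> M),
  f (fun_interp a) = fun_interp (f \o a).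
Hypothesis f_rel : forall (r : rel_sym L) (a : 'I_(rel_arity r) -> M),
  rel_interp a <-> rel_interp (f \o a).

Lemma eval_isomorphism V (v : V -> M) t : eval (f \o v) t = f (eval v t).
Proof.
elim: t => //= g a IH; rewrite f_fun; congr fun_interp.
by apply/funext => i /=; rewrite IH.
Qed.

Lemma sat_isomorphism V (v : V -> M) p : sat (f \o v) p <-> sat v p.
Proof.
have f_inj := bij_inj f_bij.
elim: p v => {V} //=.
- move=> V t u v; rewrite !eval_isomorphism; split=> [/f_inj//|->//].
- move=> V r a v; rewrite f_rel; suff -> : (fun i => eval (f \o v) (a i)) =
    f \o (fun i => eval v (a i)) by [].
  by apply/funext => i; rewrite /= eval_isomorphism.
- by move=> V p IHp q IHq v; rewrite IHp IHq.
- move=> V p IH v.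
  have E x : oapp (f \o v) (f x) = f \o oapp v x by apply/funext; case.
  case: f_bij => h hK fK; split=> H x.
    by apply/IH; rewrite -E; exact: H.
  by rewrite -(fK x) E; apply/IH.
Qed.

End Isomorphism.

(** * A countable language has countably many formulas *)

Section FormulaEnumeration.
Variables (L : language) (fun_code : fun_sym L -> nat).
Variable rel_code : rel_sym L -> nat.
Hypotheses (fun_codeI : injective fun_code) (rel_codeI : injective rel_code).

Fixpoint term_tree V (c : V -> nat) (t : term L V) : GenTree.tree nat :=
  match t with
  | Var x => GenTree.Leaf (c x)
  | App f a => GenTree.Node (fun_code f)
      [seq term_tree c (a i) | i <- enum 'I_(fun_arity f)]
  end.

(** Under a quantifier the bound variable gets code 0 and all other codes move up by one, which
    keeps the coding of variables injective. *)
Fixpoint formula_tree V (c : V -> nat) (p : formula L V) : GenTree.tree nat :=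
  match p with
  | Falsum => GenTree.Node 0 [::]
  | Equal t u => GenTree.Node 1 [:: term_tree c t; term_tree c u]
  | Rel r a => GenTree.Node 2 (GenTree.Leaf (rel_code r) ::
      [seq term_tree c (a i) | i <- enum 'I_(rel_arity r)])
  | Implies p q => GenTree.Node 3 [:: formula_tree c p; formula_tree c q]
  | Forall p => GenTree.Node 4 [:: formula_tree (oapp (S \o c) 0) p]
  end.

Lemma eq_map_enum n T (a b : 'I_n -> T) :
  [seq a i | i <- enum 'I_n] = [seq b i | i <- enum 'I_n] -> a =1 b.
Proof. by move/eq_in_map => H i; apply: H; rewrite mem_enum. Qed.

Lemma term_tree_inj V (c : V -> nat) : injective c -> injective (term_tree c).
Proof.
move=> cI; elim=> [x|f a IH] [y|g b] //=; first by case=> /cI ->.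
case=> /fun_codeI E; case: g / E b => b /eq_map_enum E; congr App.
by apply/funext => i; apply: IH.
Qed.

Lemma formula_tree_inj V (c : V -> nat) :
  injective c -> injective (formula_tree c).
Proof.
move=> cI p; elim: p c cI => {V}.
- by move=> V c cI [].
- move=> V t u c cI [] //= t' u' [].
  by move=> /(term_tree_inj cI) -> /(term_tree_inj cI) ->.
- move=> V r a c cI [] //= r' b [] /rel_codeI E.
  case: r' / E b => b /eq_map_enum E; congr Rel.
  by apply/funext => i; apply: (term_tree_inj cI).
- by move=> V p IHp q IHq c cI [] //= p' q' [] /(IHp _ cI) -> /(IHq _ cI) ->.
- move=> V p IHp c cI [] //= p' []; set c' := oapp _ _ => /IHp -> //.
  by move=> [x|] [y|] //= [] /cI ->.
Qed.

Lemma formula_enumeration V (c : V -> nat) : injective c ->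
  exists e : nat -> formula L V, forall p, exists k, e k = p.
Proof.
move=> /formula_tree_inj cI; pose code p := pickle (formula_tree c p).
have codeI : injective code by move=> p q /(pcan_inj (@pickleK _)) /cI.
exists (fun k => if pselect (exists p, code p = k) is left H then sval (cid H)
                 else Falsum L V) => p; exists (code p).
case: pselect => [H|[]]; last by exists p.
by case: cid => q /= /codeI.
Qed.

End FormulaEnumeration.

(** * Truth depends on finitely many variables *)

Section FiniteSupport.
Variables (L : language) (M : structure L).

(* The weights c only serve to state finiteness of the support uniformly for
   all types of variables, as the induction on formulas requires. *)
Lemma eval_support V (c : V -> nat) (t : term L V) : exists k,
  forall v w : V -> M, (forall x, c x < k -> v x = w x) -> eval v t = eval w t.
Proof.
elim: t => [x|f a]; first by exists (c x).+1 => v w /(_ x); apply.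
move=> /choice[k Hk]; exists (\max_i k i) => v w E /=; congr fun_interp.
apply/funext => i; apply: Hk => x /leq_trans xk; apply/E/xk.
exact: leq_bigmax.
Qed.

Lemma sat_support V (c : V -> nat) (p : formula L V) : exists k,
  forall v w : V -> M, (forall x, c x < k -> v x = w x) -> sat v p -> sat w p.
Proof.
elim: p c => {V} /=.
- by exists 0.
- move=> V t u c; have [k Hk] := eval_support c t.
  have [l Hl] := eval_support c u; exists (maxn k l) => v w E.
  rewrite (Hk v w) ?(Hl v w)// => x xk; apply: E.
    by rewrite (leq_trans xk)// leq_maxr.
  by rewrite (leq_trans xk)// leq_maxl.
- move=> V r a c.
  have /choice[k Hk] := fun i => eval_support c (a i).
  exists (\max_i k i) => v w E.
  suff -> : (fun i => eval v (a i)) = (fun i => eval w (a i)) by [].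
  apply/funext => i; apply: Hk => x /leq_trans xk; apply/E/xk.
  exact: leq_bigmax.
- move=> V p IHp q IHq c; have [k Hk] := IHp c; have [l Hl] := IHq c.
  exists (maxn k l) => v w E Hpq /(Hk w v) Hp; apply: (Hl v w) => [x xk|].
    by apply: E; rewrite (leq_trans xk)// leq_maxr.
  by apply/Hpq/Hp => x xk; rewrite E// (leq_trans xk)// leq_maxl.
- move=> V p IHp c; have [k Hk] := IHp (oapp c 0); exists k => v w E Hp x.
  by apply: Hk (Hp x) => -[y|] //=; exact: E.
Qed.

End FiniteSupport.

(** * Closure properties of the parameter-free definable sets *)

Section Definable.
Variables (L : language) (M : structure L).

Definition definable V (A : set (V -> M)) :=
  exists p : formula L V, forall v, A v <-> sat v p.

Lemma definable_setT V : definable [set: V -> M].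
Proof. by exists (Implies (Falsum _ _) (Falsum _ _)) => v /=; split=> // _. Qed.

Lemma definable_imp V (A B : set (V -> M)) : definable A -> definable B ->
  definable [set v | A v -> B v].
Proof.
by move=> [p Hp] [q Hq]; exists (Implies p q) => v /=; rewrite Hp Hq.
Qed.

Lemma definable_setC V (A : set (V -> M)) : definable A -> definable (~` A).
Proof. by move=> [p Hp]; exists (Implies p (Falsum _ _)) => v /=; rewrite -Hp. Qed.

Lemma definable_setI V (A B : set (V -> M)) :
  definable A -> definable B -> definable (A `&` B).
Proof.
move=> dA dB; have := definable_setC (definable_imp dA (definable_setC dB)).
congr (definable _); apply/seteqP; split=> v /=.
  by move/not_implyP => -[? /contrapT].
by move=> [Av Bv] /(_ Av).
Qed.

Lemma definable_setU V (A B : set (V -> M)) :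
  definable A -> definable B -> definable (A `|` B).
Proof.
move=> dA dB; rewrite -(setCK (A `|` B)) setCU.
by apply: definable_setC; apply: definable_setI; exact: definable_setC.
Qed.

Lemma definable_forall V (A : M -> set (V -> M)) :
  definable [set v : option V -> M | A (v None) (v \o some)] ->
  definable [set v | forall x, A x v].
Proof.
move=> [p Hp]; exists (Forall p) => v /=.
by split=> H x; [exact: (Hp (oapp v x)).1 (H x)|exact: (Hp (oapp v x)).2 (H x)].
Qed.

Lemma definable_exists V (A : M -> set (V -> M)) :
  definable [set v : option V -> M | A (v None) (v \o some)] ->
  definable [set v | exists x, A x v].
Proof.
move=> /definable_setC dA.
have := definable_setC (@definable_forall V (fun x => ~` A x) dA).
congr (definable _); apply/seteqP; split=> v /=; last by move=> [x Ax] /(_ x).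
by move=> /existsNP[x /contrapT Ax]; exists x.
Qed.

Lemma definable_preim V W (g : V -> W) (A : set (V -> M)) :
  definable A -> definable [set v : W -> M | A (v \o g)].
Proof. by move=> [p Hp]; exists (formula_rename g p) => v; rewrite sat_rename -Hp. Qed.

Lemma definable_eq V (t u : term L V) :
  definable [set v : V -> M | eval v t = eval v u].
Proof. by exists (Equal t u). Qed.

Lemma definable_bigcap V n (A : 'I_n -> set (V -> M)) :
  (forall i, definable (A i)) -> definable [set v | forall i, A i v].
Proof.
move=> dA; elim: n A dA => [|n IH] A dA.
  have := definable_setT V; congr (definable _).
  by apply/seteqP; split=> v //= _ [].
have := definable_setI (dA ord0) (IH (fun i => A (lift ord0 i)) (fun i => dA _)).
congr (definable _); apply/seteqP; split=> v /= => [[A0 As] i|H]; last by split.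
by case: (unliftP ord0 i) => [j|] ->.
Qed.

Lemma definable_support (A : set (nat -> M)) : definable A ->
  exists k, forall v w, (forall i, i < k -> v i = w i) -> A v -> A w.
Proof.
move=> [p Hp]; have [k Hk] := @sat_support L M nat id p.
by exists k => v w E; rewrite !Hp; exact: Hk.
Qed.

Lemma definable_image_coordinate (j : nat) (A : set (nat -> M)) :
  definable A ->
  definable [set v | exists x, A (fun i => if i == j then x else v i)].
Proof.
move=> dA; apply: definable_exists.
have := definable_preim (fun i => if i == j then None else Some i) dA.
congr (definable _); apply/seteqP; split=> v /=; congr (A _);
  by apply/funext => i /=; case: eqP.
Qed.

(** As A has finite support, the quantifier over sequences v reduces to finitely many quantifiers
    over elements. An auxiliary sequence holds w in its first n.+1 coordinates and v in the
    remaining ones. *)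
Lemma definable_projection n (t : 'I_n.+1 -> nat) (A : set (nat -> M)) :
  definable A -> definable [set w | exists2 v, A v & v \o t = w].
Proof.
move=> dA; have [k Ak] := definable_support dA.
(* All coordinates of v that A depends on or that t selects lie below K. *)
pose K := maxn k (\max_i (t i).+1).
have tK i : t i < K.
  by apply: leq_trans (leq_maxr _ _); exact: (leq_bigmax (F := fun i => (t i).+1)).
pose B := [set v : nat -> M | A (fun i => v (n.+1 + i)) /\
                              forall i, v (n.+1 + t i) = v (val i)].
have dB : definable B.
  apply: definable_setI; first exact: (definable_preim (addn n.+1)).
  apply: definable_bigcap => i.
  exact: (definable_eq (Var L (n.+1 + t i)) (Var L (val i))).
(* The first l coordinates of the part that holds v are quantified away, one at a time. *)
pose C l := [set v : nat -> M | exists2 w, B w &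
  forall i, i < n.+1 \/ n.+1 + l <= i -> w i = v i].
have dC l : definable (C l).
  elim: l => [|l IH].
    have := dB; congr (definable _); apply/seteqP; split=> v /=.
      by move=> Bv; exists v.
    move=> [w Bw E]; suff <- : w = v by [].
    by apply/funext => i; apply: E; rewrite addn0; case: ltnP; [left|right].
  have := definable_image_coordinate (n.+1 + l) IH.
  congr (definable _); apply/seteqP; split=> v /= [].
    move=> x [w Bw E]; exists w => // i H; rewrite E.
      case: eqP => // Ei; move: H; rewrite Ei addnS ltnn; case=> //.
      by rewrite ltnNge leq_addr.
    by case: H; [left|right; rewrite ltnW// -addnS].
  move=> w Bw E; exists (w (n.+1 + l)), w => // i H.
  case: eqP => [->//|ne]; apply: E; case: H => [?|H]; [by left|right].
  by rewrite addnS ltn_neqAle H andbT eq_sym; apply/eqP.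
(* The default of [inord] fills the coordinates beyond n. This is harmless: those below n.+1 + K are
   quantified in [C K], and B does not depend on the later ones. *)
have := definable_preim (fun i => inord i : 'I_n.+1) (dC K).
congr (definable _); apply/seteqP; split=> w /=.
  move=> [v [Av Ev] E]; exists (fun i => v (n.+1 + i)) => //.
  apply/funext => i /=; rewrite Ev E /= ?inord_val //; by left.
move=> [v Av <-]; exists (fun i => if i < n.+1 then v (t (inord i)) else
    if i < n.+1 + K then v (i - n.+1) else v (t (inord i))).
  split=> [|i].
    apply: Ak Av => i ik; rewrite ltnNge leq_addr /= addKn ltn_add2l.
    by rewrite (leq_trans ik) ?leq_maxl.
  by rewrite ltnNge leq_addr /= addKn ltn_add2l tK ltn_ord inord_val.
move=> i [->//|]; rewrite leqNgt => /negbTE ->.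
by case: ifP.
Qed.

End Definable.

(** * Generic countable models *)

Section Generic.
Variables (L : language) (M : structure L).
Variables (fun_code : fun_sym L -> nat) (rel_code : rel_sym L -> nat).
Hypotheses (fun_codeI : injective fun_code) (rel_codeI : injective rel_code).
Variables (n : nat) (G : set_system ('I_n -> M)).
Hypothesis G_proper : ProperFilter G.

(* Henkin forcing: C is a finite piece of information on the generic sequence of
   names, consistent with the type G of the first n names. *)
Definition condition (C : set (nat -> M)) :=
  definable C /\ forall B, G B -> exists2 v, C v & B (v \o val).

Lemma condition_setT (x : M) : condition setT.
Proof.
split=> [|B /filter_ex[w Bw]]; first exact: definable_setT.
exists (fun i => oapp w x (insub i)) => //.
by congr (B _): Bw; apply/funext => i /=; rewrite valK.
Qed.

(** If two members of G excluded the two halves of C, their intersection would exclude C. *)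
Lemma condition_split (C D : set (nat -> M)) : condition C -> definable D ->
  condition (C `&` D) \/ condition (C `&` ~` D).
Proof.
move=> [dC posC] dD; apply: contrapT => /not_orP[notD notnD].
have {}notD : exists2 B, G B & forall v, B (v \o val) -> C v -> ~ D v.
  apply: contrapT => /forall2NP noB; apply: notD.
  split=> [|B GB]; first exact: definable_setI.
  have [//|/existsNP[v /not_implyP[Bv /not_implyP[Cv /contrapT Dv]]]] := noB B.
  by exists v.
have {}notnD : exists2 B, G B & forall v, B (v \o val) -> C v -> D v.
  apply: contrapT => /forall2NP noB; apply: notnD.
  split=> [|B GB]; first by apply: definable_setI => //; exact: definable_setC.
  have [//|/existsNP[v /not_implyP[Bv /not_implyP[Cv Dv]]]] := noB B.
  by exists v.
case: notD notnD => B1 GB1 H1 [B2 GB2 H2].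
have [v Cv [B1v B2v]] := posC _ (filterI GB1 GB2).
exact: H1 B1v Cv (H2 _ B2v Cv).
Qed.

(** If C is consistent with a counterexample to the universal statement, a fresh name can be given
    that value. C, p and the type of the first n names do not notice the change. *)
Lemma condition_witness (C : set (nat -> M)) (p : formula L (option nat)) :
  condition C -> exists C', [/\ condition C', C' `<=` C &
    (C' `<=` [set v : nat -> M | forall x, sat (oapp v x) p]) \/
    exists i, C' `<=` [set v : nat -> M | ~ sat (oapp v (v i)) p]].
Proof.
move=> cC; pose D := [set v : nat -> M | forall x, sat (oapp v x) p].
have dD : definable D by exists (Forall p).
have [cD|[_ posD]] := condition_split cC dD.
  by exists (C `&` D); split; [|exact: subIsetl|left; exact: subIsetr].
have [k Ck] := definable_support cC.1.
have [l pl] := @sat_support L M (option nat) (oapp id 0) p.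
(* The name i is fresh: it is beyond the first n names and beyond the supports of C and p. *)
pose i := maxn n (maxn k l).
exists (C `&` [set v : nat -> M | ~ sat (oapp v (v i)) p]).
split; [|exact: subIsetl|by right; exists i; exact: subIsetr].
split.
  apply: definable_setI; first exact: cC.1.
  apply: definable_setC; exists (formula_rename (oapp id i) p) => v.
  rewrite sat_rename; suff -> : v \o oapp id i = oapp v (v i) by [].
  by apply/funext; case.
move=> B /posD[v [Cv /existsNP[x px]] Bv].
pose w j := if j == i then x else v j.
have wE j : j < i -> w j = v j by rewrite /w; case: ltngtP.
exists w.
  split.
    by apply: Ck Cv => j jk; rewrite wE// /i !leq_max jk orbT.
  move=> pw; apply: px; apply: pl pw => -[j|] /=; last by rewrite /w eqxx.
  by move=> jl; rewrite wE// /i !leq_max jl !orbT.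
congr (B _): Bv; apply/funext => j /=; rewrite wE//.
by rewrite /i leq_max ltn_ord.
Qed.

Variable req : nat -> set (nat -> M) -> Prop.
Hypothesis req_dense : forall k C, condition C ->
  exists C', [/\ condition C', C' `<=` C & req k C'].

(** There are countably many formulas and requirements, so a descending sequence of conditions can
    settle those with number k at step k. F is the filter that the sequence generates. *)
Lemma generic_filter (x : M) : exists F : set_system (nat -> M),
  [/\ ProperFilter F,
      forall p : formula L nat, F [set v | sat v p] \/ F [set v | ~ sat v p],
      forall p : formula L (option nat),
        F [set v : nat -> M | forall x, sat (oapp v x) p] \/
        exists i, F [set v : nat -> M | ~ sat (oapp v (v i)) p],
      forall A B, F A -> G B -> exists2 v, A v & B (v \o val)
    & forall k, exists2 C, F C & req k C].
Proof.
have [e eP] := formula_enumeration fun_codeI rel_codeI (@inj_id nat).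
have [e' e'P] : exists e : nat -> formula L (option nat),
    forall p, exists k, e k = p.
  apply: (formula_enumeration fun_codeI rel_codeI (c := oapp S 0)).
  by move=> [i|] [j|] //= [->].
pose good k (C C' : set (nat -> M)) := [/\ condition C', C' `<=` C,
  (C' `<=` [set v | sat v (e k)]) \/ (C' `<=` [set v | ~ sat v (e k)]),
  (C' `<=` [set v : nat -> M | forall x, sat (oapp v x) (e' k)]) \/
    exists i, C' `<=` [set v : nat -> M | ~ sat (oapp v (v i)) (e' k)] & req k C'].
have good_ex k C : condition C -> exists C', good k C C'.
  move=> cC.
  have [C1 [cC1 C1C e1]] : exists C1, [/\ condition C1, C1 `<=` C &
      (C1 `<=` [set v | sat v (e k)]) \/ (C1 `<=` [set v | ~ sat v (e k)])].
    have de : definable [set v : nat -> M | sat v (e k)] by exists (e k).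
    have [c|c] := condition_split cC de; eexists; split; try exact: c.
    - exact: subIsetl.
    - by left; exact: subIsetr.
    - exact: subIsetl.
    - by right; exact: subIsetr.
  have [C2 [cC2 C21 e2]] := condition_witness (e' k) cC1.
  have [C3 [cC3 C32 r3]] := req_dense k cC2.
  have C31 := subset_trans C32 C21.
  exists C3; split=> //; first exact: subset_trans C31 C1C.
    by case: e1 => e1; [left|right]; exact: subset_trans C31 e1.
  case: e2 => [e2|[i e2]]; [left|right; exists i]; exact: subset_trans C32 e2.
have [s [s0 sS]] : exists s : nat -> {C | condition C},
    s 0 = exist _ _ (condition_setT x) /\
    forall k, good k (sval (s k)) (sval (s k.+1)).
  have /choice[st Hst] : forall (kC : nat * {C | condition C}),
      exists C' : {C | condition C}, good kC.1 (sval kC.2) (sval C').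
    move=> [k [C cC]] /=; have [C' gC'] := good_ex k C cC.
    by case: (gC') => cC' _ _ _ _; exists (exist _ C' cC').
  exists (fix s k := if k is j.+1 then st (j, s j) else exist _ _ (condition_setT x)).
  by split=> // k; exact: (Hst (k, _)).
pose c k := sval (s k).
have cS k : c k.+1 `<=` c k by case: (sS k).
have c_le i j : i <= j -> c j `<=` c i.
  move=> /subnK <-; elim: (j - i) => // m IH.
  by rewrite addSn; exact: subset_trans (cS _) IH.
have cc k : condition (c k) by exact: svalP.
pose F := [set A : set (nat -> M) | exists k, c k `<=` A].
exists F; split.
- apply: Build_ProperFilter_ex.
    by move=> A [k kA]; have [v cv _] := (cc k).2 _ filterT; exists v; exact: kA.
  split; first by exists 0.
  + move=> A B [i iA] [j jB]; exists (maxn i j) => v cv; split.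
      by apply: iA; exact: c_le (leq_maxl _ _) _ cv.
    by apply: jB; exact: c_le (leq_maxr _ _) _ cv.
  + by move=> A B AB [k kA]; exists k; exact: subset_trans kA AB.
- move=> p; have [k <-] := eP p.
  by case: (sS k) => _ _ [] H _ _; [left|right]; exists k.+1.
- move=> p; have [k <-] := e'P p.
  case: (sS k) => _ _ _ [H|[i H]] _; [left|right; exists i]; exists k.+1 => //.
- by move=> A B [k kA] /(cc k).2[v cv Bv]; exists v => //; exact: kA.
- by move=> k; exists (c k.+1); [exists k.+1|case: (sS k)].
Qed.

End Generic.

(** * The Henkin model of a generic filter *)

Section HenkinModel.
Variables (L : language) (M : structure L) (F : set_system (nat -> M)).
Hypothesis F_proper : ProperFilter F.
Hypothesis F_ultra : forall p : formula L nat,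
  F [set v | sat v p] \/ F [set v | ~ sat v p].
Hypothesis F_witness : forall p : formula L (option nat),
  F [set v : nat -> M | forall x, sat (oapp v x) p] \/
  exists i, F [set v : nat -> M | ~ sat (oapp v (v i)) p].

(** Names that F makes equal are to be identified. [xget] depends only on the class as a set, so
    [rep] picks one number in each class, and the model can live on these numbers instead of a
    quotient. *)
Let same i := [set j | F [set v | v i = v j]].
Let rep i := xget 0 (same i).

Let repP i : F [set v | v i = v (rep i)].
Proof.
rewrite /rep; case: xgetP => [j ->//|/(_ i)[]].
by apply: filterS filterT => v _.
Qed.

Let eq_rep i j : F [set v | v i = v j] -> rep i = rep j.
Proof.
move=> E; congr xget; apply/seteqP; split=> k; apply: filterS2 E => v /= -> //.
Qed.

Let repK i : rep (rep i) == rep i.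
Proof. by apply/eqP/esym/eq_rep/repP. Qed.

Let name := {i : nat | rep i == i}.
Let nm i : name := exist _ (rep i) (repK i).

(** The witness property is applied to the formula saying that x differs from f(a), which cannot
    hold for all x. *)
Let F_value (f : fun_sym L) (a : 'I_(fun_arity f) -> name) :
  exists j, F [set v | v j = fun_interp (v \o val \o a)].
Proof.
have [] := F_witness (Implies (Equal (Var L None)
    (App (fun i => Var L (Some (val (a i)))))) (Falsum L _)).
  by case/filter_ex => v /(_ (fun_interp (v \o val \o a))) /=; case.
by move=> [j Fj]; exists j; apply: filterS Fj => v /= /contrapT.
Qed.

Definition henkin_model : structure L := @Structure L name
  (fun f a => nm (sval (cid (F_value a))))
  (fun r a => F [set v : nat -> M | rel_interp (v \o val \o a)]).

Definition henkin_index (x : henkin_model) : nat := val (x : name).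
Definition henkin_name (i : nat) : henkin_model := nm i.

Lemma henkin_nameK i : F [set v | v i = v (henkin_index (henkin_name i))].
Proof. exact: repP. Qed.

Lemma henkin_indexI x y :
  F [set v | v (henkin_index x) = v (henkin_index y)] -> x = y.
Proof.
move=> /eq_rep E; apply: val_inj.
by rewrite -(eqP (valP (x : name))) -(eqP (valP (y : name))).
Qed.

Lemma henkin_countable : countable [set: henkin_model].
Proof.
by apply/countable_injP; exists henkin_index => x y _ _ E; exact: val_inj E.
Qed.

Lemma eval_henkin V (y : V -> henkin_model) t :
  F [set v : nat -> M | v (henkin_index (eval y t)) = eval (v \o henkin_index \o y) t].
Proof.
elim: t => [x|f a IH] /=; first by apply: filterS filterT => v.
set b := fun i => eval y (a i); case: cid => j /= Fj.
have {}IH : F [set v : nat -> M | forall i, v (henkin_index (b i)) =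
    eval (v \o henkin_index \o y) (a i)] by exact: filter_forall.
apply: filterS3 (henkin_nameK j) Fj IH => v /= <- -> E; congr fun_interp.
by apply/funext => i; exact: E.
Qed.

(** An analogue of the theorem of Los: [F_ultra] serves implications and [F_witness] quantifiers.
    Formulas are first renamed to have names as variables, since F decides only those. *)
Lemma sat_henkin V (y : V -> henkin_model) p :
  sat y p <-> F [set v : nat -> M | sat (v \o henkin_index \o y) p].
Proof.
elim: p y => {V}.
- by move=> V y; split=> // /filter_ex[].
- move=> V t u y; have Ft := eval_henkin y t; have Fu := eval_henkin y u.
  split=> [E|E].
    by apply: filterS2 Ft Fu => v /= <- <-; rewrite E.
  by apply: henkin_indexI; apply: filterS3 Ft Fu E => v /= -> ->.
- move=> V r a y; 
  have Fa : F [set v : nat -> M | forall i, v (henkin_index (eval y (a i))) =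
      eval (v \o henkin_index \o y) (a i)].
    by apply: filter_forall => i; exact: eval_henkin.
  have E v : (forall i, v (henkin_index (eval y (a i))) =
      eval (v \o henkin_index \o y) (a i)) ->
    (v \o val \o fun i => eval y (a i)) =
      (fun i => eval (v \o henkin_index \o y) (a i)).
    by move=> E; apply/funext => i; exact: E.
  by split; apply: filterS2 Fa => v /= /E; [move=> <-|move=> ->].
- move=> V p IHp q IHq y; rewrite [sat y _]/= IHp IHq; split=> H.
    have [Fp|Fp] := F_ultra (formula_rename (henkin_index \o y) p).
      have {}Fp : F [set v : nat -> M | sat (v \o henkin_index \o y) p].
        by apply: filterS Fp => v /= /sat_rename.
      by apply: filterS (H Fp) => v Hv _.
    by apply: filterS Fp => v /= np sp; case: np; apply/sat_rename.
  by move=> Fp; apply: filterS2 H Fp => v /=; apply.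
- move=> V p IH y.
  have Ey v x : v \o henkin_index \o oapp y x =
      oapp (v \o henkin_index \o y) (v (henkin_index x)) by apply/funext; case.
  split=> [H|H x]; last by apply/IH; apply: filterS H => v /= Hv; rewrite Ey.
  have Er (v : nat -> M) x : oapp v x \o omap (henkin_index \o y) =
    oapp (v \o henkin_index \o y) x by apply/funext; case.
  have [Fp|[i Fp]] := F_witness (formula_rename (omap (henkin_index \o y)) p).
    by apply: filterS Fp => v /= + x => /(_ x)/sat_rename; rewrite Er.
  have /IH Fi := H (henkin_name i).
  have [v /= [[np +] E]] := filter_ex (filterI (filterI Fp Fi) (henkin_nameK i)).
  by rewrite Ey -E -Er => /sat_rename.
Qed.

Lemma henkin_elementary : models henkin_model (complete_theory M).
Proof.
move=> s; rewrite /complete_theory /= => Ms; apply/sat_henkin.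
by apply: filterS filterT => v _ /=; congr (sat _ s): Ms; apply/funext; case.
Qed.

End HenkinModel.

(** * The Ryll-Nardzewski theorem *)

Section Atoms.
Variables (L : language) (M : structure L) (V : Type).
Implicit Types D E : set (V -> M).

Definition definable_atom D := [/\ definable D, D !=set0 &
  forall E, definable E -> E `<=` D -> E = set0 \/ E = D].

(** A definable set contains every atom that it meets, so it is a union of atoms from s. *)
Lemma finite_definable_of_atoms (s : seq (set (V -> M))) :
  (forall D, D \in s -> definable_atom D) -> (forall v, exists2 D, D \in s & D v) ->
  finite_set [set E : set (V -> M) | definable E].
Proof.
move=> s_atom s_cover.
pose U (m : {ffun 'I_(size s) -> bool}) : set (V -> M) :=
  [set v | exists2 i, m i & nth set0 s i v].
apply: (@sub_finite_set _ _ (range U)); last exact/finite_image/finite_finset.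
move=> E /= dE; exists [ffun i : 'I_(size s) => `[< nth set0 s i `<=` E >]] => //.
apply/seteqP; split=> v /=.
  by move=> [i]; rewrite ffunE => /asboolP; exact.
move=> Ev; have [D Ds Dv] := s_cover v.
have Di : index D s < size s by rewrite index_mem.
have nthD : nth set0 s (Ordinal Di) = D by rewrite nth_index.
exists (Ordinal Di); rewrite ?ffunE nthD//; apply/asboolP.
have [dD _ minD] := s_atom _ Ds.
have [|E0|ED] := minD (E `&` D) (definable_setI dE dD); first exact: subIsetr.
  by suff : (E `&` D) v by rewrite E0.
by rewrite -ED; exact: subIsetl.
Qed.

(* A type containing the complements of all atoms is not isolated. *)
Lemma nonisolated_type : ~ finite_set [set E : set (V -> M) | definable E] ->
  exists2 U : set_system (V -> M), UltraFilter U &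
    forall D, definable_atom D -> U (~` D).
Proof.
move=> inf.
(* F is generated by the complements of the atoms. It is proper, since otherwise finitely many atoms
   would cover the space. *)
pose F := [set A : set (V -> M) | exists2 s : seq (set (V -> M)),
  (forall D, D \in s -> definable_atom D) &
  forall v, (forall D, D \in s -> ~ D v) -> A v].
have FF : ProperFilter F.
  apply: Build_ProperFilter_ex.
    move=> A [s s_atom sA]; apply: contrapT => A0; apply: inf.
    apply: (finite_definable_of_atoms s_atom) => v.
    apply: contrapT => /forall2NP nD; apply: A0; exists v; apply: sA => D Ds.
    by case: (nD D).
  split; first by exists [::].
  - move=> A B [s s_atom sA] [r r_atom rB]; exists (s ++ r).
      by move=> D; rewrite mem_cat => /orP[/s_atom|/r_atom].
    by move=> v H; split; [apply: sA|apply: rB] => D DD; apply: H;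
      rewrite mem_cat DD ?orbT.
  - by move=> A B AB [s s_atom sA]; exists s => // v /sA/AB.
have [U [UU FU]] := ultraFilterLemma FF; exists U => // D Da.
apply: FU; exists [:: D] => [E|v]; first by rewrite inE => /eqP ->.
by apply; rewrite inE.
Qed.

End Atoms.

(** Otherwise there is a non-isolated type U. One generic model realizes it by its first names and
    another one omits it, yet both are countable models of the theory of M, hence isomorphic to
    N. *)
Theorem ryll_nardzewski (L : language) (M : structure L) (x : M)
    (fun_code : fun_sym L -> nat) (rel_code : rel_sym L -> nat) (n : nat) :
  injective fun_code -> injective rel_code -> omega_categorical M ->
  finite_set [set E : set ('I_n.+1 -> M) | definable E].
Proof.
move=> fI rI [N [_ _ N_unique]]; apply: contrapT => /nonisolated_type[U UU U_atom].
have no_req (k : nat) C : condition U C ->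
  exists C', [/\ condition U C', C' `<=` C & True] by move=> cC; exists C; split.
have [F1 [F1p F1u F1w F1U _]] :=
  generic_filter fI rI (@ultra_proper _ U UU) no_req x.
pose trivial := [set setT] : set_system ('I_n.+1 -> M).
have trivial_proper : ProperFilter trivial.
  by apply: Build_ProperFilter_ex => A ->; exists (fun=> x).
(* Requirement k says that the tuple of names with number k does not realize U. *)
pose req k (C : set (nat -> M)) := forall t : {ffun 'I_n.+1 -> nat},
  unpickle k = Some t -> exists B, [/\ U B, definable B &
    C `<=` [set v : nat -> M | ~ B (v \o t)]].
have req_dense k C : condition trivial C ->
    exists C', [/\ condition trivial C', C' `<=` C & req k C'].
  move=> [dC posC]; rewrite /req; case: unpickle => [t|]; last by exists C; split.
  have [v0 Cv0 _] := posC setT erefl.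
  suff [B [UB dB [v Cv nBv]]] : exists B, [/\ U B, definable B &
      exists2 v, C v & ~ B (v \o t)].
    exists (C `&` [set v : nat -> M | ~ B (v \o t)]); split; last first.
    - by move=> _ [<-]; exists B; split=> //; exact: subIsetr.
    - exact: subIsetl.
    split; last by move=> _ ->; exists v.
    apply: definable_setI => //; apply: definable_setC.
    exact: definable_preim.
  apply: contrapT => noB.
  have {}noB B : U B -> definable B -> forall v, C v -> B (v \o t).
    move=> UB dB v Cv; apply: contrapT => nBv; apply: noB.
    by exists B; split=> //; exists v.
  (* The projection D of C along t now lies in every definable member of U. Hence every definable
     set that meets D belongs to U, so D is an atom and a member of U, against [U_atom]. *)
  pose D := [set w : 'I_n.+1 -> M | exists2 v, C v & v \o t = w].
  have dD : definable D by exact: definable_projection.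
  have DB B : U B -> definable B -> D `<=` B.
    by move=> UB dB _ [v Cv <-]; exact: noB.
  have UD E : definable E -> (E `&` D) !=set0 -> U E.
    move=> dE [w [Ew Dw]]; have [//|UnE] := in_ultra_setVsetC E UU.
    by have := DB _ UnE (definable_setC dE) _ Dw.
  have D0 : D !=set0 by exists (v0 \o t), v0.
  have D_atom : definable_atom D.
    split=> // E dE ED; have [->|/set0P E0] := eqVneq E set0; first by left.
    right; apply/seteqP; split=> //; apply: DB => //; apply: UD => //.
    by rewrite (setIidl ED).
  have [] := filter_not_empty U.
  rewrite -(setICr D); apply: filterI; last exact: U_atom.
  by apply: UD; rewrite ?setIid.
have [F2 [F2p F2u F2w _ F2r]] := generic_filter fI rI trivial_proper req_dense x.
pose H1 := henkin_model F1p F1w; pose H2 := henkin_model F2p F2w.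
have [f1 [f1b f1f f1r]] := N_unique H1 (henkin_countable _ _)
  (henkin_elementary F1p F1u F1w).
have [f2 [f2b f2f f2r]] := N_unique H2 (henkin_countable _ _)
  (henkin_elementary F2p F2u F2w).
have [g1 f1K g1K] := f1b.
(* The tuple [t1] realizes U in [H1]. Its image [t2] under the isomorphism through N has names in
   [H2], where it must violate the formula p of some member of U. *)
pose t1 (i : 'I_n.+1) : H1 := henkin_name F1p F1w (val i).
pose t2 := f2 \o g1 \o t1.
pose t := [ffun i => henkin_index (t2 i)].
have [C F2C /(_ t (pickleK t))[B [UB [p Bp] CB]]] := F2r (pickle t).
have sat1 : sat t1 p.
  apply: (sat_henkin F1u t1 p).2.
  have [Fp|Fp] := F1u (formula_rename val p); last first.
    have [v nv /Bp/sat_rename pv] := F1U _ _ Fp UB.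
    by [].
  have Ft : F1 [set v | forall i, v (val i) = v (henkin_index (t1 i))].
    by apply: filter_forall => i; exact: henkin_nameK.
  apply: filterS2 Fp Ft => v /= /sat_rename + E.
  by congr (sat _ p); apply/funext => i /=; rewrite E.
have : sat t2 p.
  apply/(sat_isomorphism f2b f2f f2r)/(sat_isomorphism f1b f1f f1r).
  suff -> : f1 \o (g1 \o t1) = t1 by [].
  by apply/funext => i /=; rewrite g1K.
move=> /(sat_henkin F2u t2 p).1 Fp.
have [v [Cv pv]] := filter_ex (filterI F2C Fp).
apply: (CB v Cv); apply/Bp; congr (sat _ p): pv.
by apply/funext => i /=; rewrite ffunE.
Qed.

Lemma definable_repeat (L : language) (M : structure L) (x : M)
    (fun_code : fun_sym L -> nat) (rel_code : rel_sym L -> nat) (n : nat)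
    (A : nat -> set ('I_n.+1 -> M)) :
  injective fun_code -> injective rel_code -> omega_categorical M ->
  (forall k, definable (A k)) -> exists i j, i < j /\ A i = A j.
Proof.
move=> fI rI /(ryll_nardzewski x n fI rI) fin dA; apply: contrapT => noij.
have AI : injective A.
  by move=> i j E; case: (ltngtP i j) => // ij; case: noij;
    [exists i, j|exists j, i].
apply: infinite_nat; suff <- : A @^-1` [set E | definable E] = setT.
  by apply: finite_preimage fin => i j _ _ /AI.
by apply/seteqP; split=> k // _; exact: dA.
Qed.

(** * Consequences of omega-categoricity and NSOP *)

Local Open Scope ring_scope.
Local Notation "x ** y" := (rngmul x y) (at level 40, left associativity).

(* [rngpow x k] is the power of x with exponent k + 1. *)
Definition rngpow (R : rngType) (x : R) (k : nat) : R := iter k (rngmul x) x.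

(* The preorder induced by inclusion of the sets {b} U Rb. *)
Definition left_mult (R : rngType) (b c : R) := b = c \/ exists r, b = r ** c.

Definition left_smult (R : rngType) (b c : R) := left_mult b c /\ ~ left_mult c b.

(** The chain ascends from b. The recursion makes this a first-order condition on b for each k. *)
Fixpoint starts_chain (R : rngType) (k : nat) (b : R) : Prop :=
  if k is j.+1 then exists c, left_smult b c /\ starts_chain j c else True.

Lemma left_mult_trans (R : rngType) (a b c : R) :
  left_mult a b -> left_mult b c -> left_mult a c.
Proof.
move=> [->//|[r ->]] [->|[s ->]]; right; first by exists r.
by exists (r ** s); rewrite rngmulA.
Qed.

Lemma starts_chainW (R : rngType) k j (b : R) :
  (j <= k)%N -> starts_chain k b -> starts_chain j b.
Proof.
elim: k j b => [|k IH] [|j] b //= jk [c [bc ck]].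
by exists c; split=> //; exact: IH ck.
Qed.

Section RingLogic.
Variable R : rngType.
Local Notation M := (ring_structure R).

Lemma definable_mul V (x y z : V) :
  definable [set v : V -> M | v x = v y ** v z].
Proof.
pose t := App (L := ring_language) (f := RingMul)
  (fun i => if i == ord0 then Var ring_language y else Var ring_language z).
have := @definable_eq _ M V (Var _ x) t.
by congr (definable _).
Qed.

Lemma definable_pow V k (x y : V) :
  definable [set v : V -> M | v y = rngpow (v x) k].
Proof.
elim: k V x y => [|k IH] V x y.
  exact: (@definable_eq _ M V (Var _ y) (Var _ x)).
have := @definable_exists _ M V
  (fun z => [set v : V -> M | z = rngpow (v x) k /\ v y = v x ** z]).
move=> /(_ (definable_setI (IH _ (Some x) None)
  (definable_mul (Some y) (Some x) None))).
congr (definable _); apply/seteqP; split=> v /=; first by move=> [z [-> ->]].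
by move=> ->; eexists.
Qed.

Lemma definable_left_mult V (x y : V) :
  definable [set v : V -> M | left_mult (v x) (v y)].
Proof.
exact: definable_setU (@definable_eq _ M V (Var _ x) (Var _ y))
  (@definable_exists _ M V (fun r => [set v : V -> M | v x = r ** v y])
    (definable_mul (Some x) None (Some y))).
Qed.

Lemma definable_starts_chain V k (x : V) :
  definable [set v : V -> M | starts_chain k (v x)].
Proof.
elim: k V x => [|k IH] V x /=; first exact: definable_setT.
apply: (@definable_exists _ M V (fun c =>
  [set v : V -> M | left_smult (v x : R) c /\ starts_chain k (c : R)])).
exact: definable_setI (definable_setI (definable_left_mult (Some x) None)
  (definable_setC (definable_left_mult None (Some x)))) (IH _ None).
Qed.

Hypothesis omega_cat : omega_categorical M.

Lemma ring_definable_repeat n (A : nat -> set ('I_n.+1 -> M)) :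
  (forall k, definable (A k)) -> exists i j, (i < j)%N /\ A i = A j.
Proof.
pose fun_code (f : fun_sym ring_language) : nat := match f with
  | RingZero => 0 | RingAdd => 1 | RingOpp => 2 | RingMul => 3 end.
have fun_codeI : injective fun_code by move=> [] [].
have rel_codeI : injective (of_void nat : rel_sym ring_language -> nat) by case.
exact: (@definable_repeat _ M (0 : R) _ _ _ _ fun_codeI rel_codeI).
Qed.

Lemma uniform_power_repeat :
  exists i j, (i < j)%N /\ forall x : R, rngpow x i = rngpow x j.
Proof.
have [i [j [ij E]]] := ring_definable_repeat
  (fun k => @definable_pow 'I_2 k ord0 ord_max).
exists i, j; split=> // x.
pose v (l : 'I_2) : R := if l == ord0 then x else rngpow x i.
have : [set v : 'I_2 -> M | v ord_max = rngpow (v ord0) i] v by [].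
by rewrite E.
Qed.

Hypothesis nsop : ~ strict_order_property (complete_theory M).

Lemma bounded_chains : exists N, forall b : R, ~ starts_chain N b.
Proof.
have [i [j [ij E]]] := ring_definable_repeat
  (fun k => @definable_starts_chain 'I_1 k ord0).
exists i => b ib; apply: nsop.
(* An element that starts a chain of length i also starts one of length j > i, whose next element
   again starts a chain of length i. Iteration yields an infinite chain. *)
have ext (c : {c : R | starts_chain i c}) :
    exists d : {c : R | starts_chain i c}, left_smult (sval c) (sval d).
  case: c => c ic /=.
  have : [set v : 'I_1 -> M | starts_chain i (v ord0)] (fun=> c) by [].
  rewrite E => /(starts_chainW ij) [d [cd id]].
  by exists (exist _ d id).
have /choice[next nextP] := ext.
pose s k := sval (iter k next (exist _ b ib)).
exists M; split=> //.
have [p Hp] := definable_left_mult (inl ord0 : 'I_1 + 'I_1) (inr ord0).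
exists 1%N, 1%N, p, (fun k _ => s k) => k.
have sS : left_smult (s k) (s k.+1) by exact: nextP.
have Dp l (a : 'I_1 -> M) :
    @definable_set _ M _ _ p (fun=> s l) a <-> left_mult (a ord0 : R) (s l).
  by rewrite /definable_set /= -Hp.
split=> [a /Dp H|/(_ (fun=> s k.+1)) H].
  by apply/Dp; exact: left_mult_trans H sS.1.
by apply: sS.2; apply: (Dp k (fun=> s k.+1)).1; apply: H; apply/Dp; left.
Qed.

End RingLogic.

(** * Division rings of bounded exponent *)

(** A nonempty fibre of f on K lies in a translate of the kernel. *)
Lemma finite_preim_additive (U V : zmodType) (K : set U) (f : U -> V) (T : set V) :
  (forall x y, K x -> K y -> K (x - y)) ->
  (forall x y, f (x - y) = f x - f y) ->
  finite_set [set x | K x /\ f x = 0] -> finite_set T ->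
  finite_set [set x | K x /\ T (f x)].
Proof.
move=> KB fB ker_fin T_fin.
apply: (@sub_finite_set _ _
  (\bigcup_(t in T) [set x | K x /\ f x = t])) => [x [Kx Tx]|].
  by exists (f x).
apply: bigcup_finite => // t _.
have [[y [Ky fy]]|no] := pselect (exists y, K y /\ f y = t); last first.
  suff -> : [set x | K x /\ f x = t] = set0 by exact: finite_set0.
  by apply/seteqP; split=> // x Hx; case: no; exists x.
apply: sub_finite_set (finite_image (fun z => z + y) ker_fin) => x [Kx fx] /=.
by exists (x - y); rewrite ?subrK//; split; [exact: KB|rewrite fB fx fy subrr].
Qed.

Section BoundedExponent.
Variables (D : unitRingType) (m : nat).
Hypothesis m_gt0 : (0 < m)%N.
Hypothesis D_exp : forall x : D, x != 0 -> x ^+ m = 1.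

Let D_unit (x : D) : x != 0 -> x \is a GRing.unit.
Proof.
move=> /D_exp E; apply/unitrP; exists (x ^+ m.-1).
by rewrite -exprSr -exprS prednK.
Qed.

Section Eigenspaces.
Variable a : D.

Let roots := fix roots k := if k is j.+1 then a ^+ j :: roots j else [::].

(* The product of the commuting operators x |-> x a - a^i x for i < k. *)
Let w := fix w k (x : D) := if k is j.+1 then w j x * a - a ^+ j * w j x else x.

(** Coefficients stand on the left in an evaluation at a, so a factor X becomes right multiplication
    by a and a constant factor becomes left multiplication. *)
Lemma weight_horner k x : w k x = (\prod_(z <- roots k) ('X - z%:P) * x%:P).[a].
Proof.
elim: k => [|k IH] /=; first by rewrite big_nil mul1r hornerC.
rewrite big_cons IH -!mulrA; set p := _ * x%:P.
by rewrite mulrBl -commr_polyX hornerD hornerN hornerMX hornerCM.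
Qed.

(** The a^i with i < n are n distinct commuting roots of X^n - 1. So the product of the X - a^i is
    X^n - 1, whose operator sends x to x a^n - x = 0. *)
Lemma weight_order n x : n.-primitive_root a -> w n x = 0.
Proof.
move=> pa; have n0 := prim_order_gt0 pa.
have a0 : a != 0.
  apply/eqP => a0; have := prim_expr_order pa.
  by rewrite a0 expr0n eqn0Ngt n0 => /esym/eqP; rewrite oner_eq0.
rewrite weight_horner.
have urs k : (k <= n)%N -> uniq_roots (roots k).
  elim: k => //= k IH kn; rewrite IH ?andbT 1?ltnW//.
  suff H j : (j <= k)%N -> all (diff_roots (a ^+ k)) (roots j) by exact: H.
  elim: j => //= j IHj jk; rewrite IHj 1?ltnW// andbT /diff_roots.
  rewrite -!exprD addnC eqxx /=; apply: D_unit; rewrite subr_eq0.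
  rewrite (eq_prim_root_expr pa) !modn_small ?(ltn_trans jk)//.
  by rewrite neq_ltn jk.
have ars k : all (root ('X^n - 1%:P)) (roots k).
  elim: k => //= k ->; rewrite andbT rootE hornerD hornerN hornerXn hornerC.
  by rewrite exprAC (prim_expr_order pa) expr1n subrr.
have szrs k : size (roots k) = k by elim: k => //= k ->.
have := all_roots_prod_XsubC _ (ars n) (urs n (leqnn n)).
rewrite szrs size_XnsubC// => /(_ erefl); rewrite lead_coefXnsubC// scale1r => <-.
rewrite mulrBl -commr_polyXn hornerD hornerN !hornerCM hornerXn hornerC mul1r.
by rewrite (prim_expr_order pa) mulr1 subrr.
Qed.

(* As w n = 0, some equation y a = a^k y has infinitely many solutions in K, and
   the quotients y0^-1 y of its solutions commute with a. *)
Lemma infinite_centralizer (K : set D) : K a ->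
  (forall x y, K x -> K y -> K (x - y)) -> (forall x y, K x -> K y -> K (x * y)) ->
  infinite_set K -> infinite_set [set x | K x /\ x * a = a * x].
Proof.
move=> Ka KB KM K_inf C_fin; apply: K_inf.
have [a0|a0] := eqVneq a 0.
  apply: sub_finite_set C_fin => x Kx; split=> //.
  by rewrite a0 mulr0 mul0r.
have KX x k : K x -> K (x ^+ k.+1).
  by move=> Kx; elim: k => // k IH; rewrite exprS; exact: KM.
have [n pa _] := prim_order_exists m_gt0 (D_exp a0).
have KaX k y : K y -> K (a ^+ k * y).
  by case: k => [|k] Ky; rewrite ?mul1r//; apply: KM => //; exact: KX.
have KV y : K y -> y != 0 -> K y^-1.
  move=> Ky y0; suff -> : y^-1 = y ^+ (m.-1 + m).
    by rewrite -(prednK m_gt0) addnS; exact: KX.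
  apply: (mulrI (D_unit y0)); rewrite divrr ?D_unit// -exprS -addSn prednK//.
  by rewrite exprD D_exp// mulr1.
have ker_fin k : finite_set [set y | K y /\ y * a - a ^+ k * y = 0].
  have [[y0 [y0N0 [Ky0 /subr0_eq y0a]]]|no] :=
    pselect (exists y0, y0 != 0 /\ (K y0 /\ y0 * a - a ^+ k * y0 = 0)); last first.
    apply: sub_finite_set (finite_set1 0) => y Hy /=.
    by apply: contrapT => /eqP y0; apply: no; exists y.
  have inj : injective (fun y => y0^-1 * y) by apply: mulrI; rewrite unitrV D_unit.
  apply: sub_finite_set (finite_preimage (f := fun y => y0^-1 * y) _ C_fin).
    move=> y [Ky /subr0_eq ya] /=; split; first exact/KM/Ky/KV.
    rewrite -mulrA ya !mulrA; congr (_ * y).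
    apply: (mulrI (D_unit y0N0)); rewrite mulrA divrr ?D_unit// mul1r mulrA y0a.
    by rewrite -mulrA divrr ?D_unit// mulr1.
  by move=> x y _ _ /inj.
have wB k x y : w k (x - y) = w k x - w k y.
  by elim: k => //= k ->; rewrite mulrBl mulrBr !opprD addrACA.
have wK k x : K x -> K (w k x).
  by move=> Kx; elim: k => //= k IH; apply: KB; [exact: KM|exact: KaX].
have wker k : finite_set [set x | K x /\ w k x = 0].
  elim: k => [|k IH] /=.
    by apply: sub_finite_set (finite_set1 0) => x [_ ->].
  apply: sub_finite_set (finite_preim_additive KB (wB k) IH (ker_fin k)).
  by move=> x [Kx Hx]; split=> //; split=> //; exact: wK.
by apply: sub_finite_set (wker n) => x Kx; split=> //; exact: weight_order.
Qed.

End Eigenspaces.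

Lemma finite_of_bounded_exponent : finite_set [set: D].
Proof.
apply: contrapT => D_inf.
(* The common centralizer of s is an infinite subring, so it has an element a outside s. By
   [infinite_centralizer] it remains infinite when commuting with a is required too. *)
have seq_ex k : exists s : seq D, [/\ size s = k, uniq s,
    {in s &, forall x y, x * y = y * x} &
    infinite_set [set x | forall y, y \in s -> x * y = y * x]].
  elim: k => [|k [s [szs us cs Cs]]].
    exists [::]; split=> // fin; apply: D_inf.
    by apply: sub_finite_set fin => x _ y.
  have [|a [/= Ca /negP as_]] := @infinite_setN0 _
    ([set x | forall y, y \in s -> x * y = y * x] `\` [set` s]).
    by apply: infinite_setD => //; exact: finite_seq.
  exists (a :: s); split; rewrite /= ?szs ?as_//.
    move=> x y; rewrite !inE => /orP[/eqP->|xs] /orP[/eqP->|ys] //.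
    - exact: Ca.
    - by rewrite Ca.
    - exact: cs.
  have CB x y : (forall z, z \in s -> x * z = z * x) ->
      (forall z, z \in s -> y * z = z * y) ->
      forall z, z \in s -> (x - y) * z = z * (x - y).
    by move=> Hx Hy z zs; rewrite mulrBl mulrBr Hx// Hy.
  have CM x y : (forall z, z \in s -> x * z = z * x) ->
      (forall z, z \in s -> y * z = z * y) ->
      forall z, z \in s -> (x * y) * z = z * (x * y).
    by move=> Hx Hy z zs; rewrite -mulrA Hy// mulrA Hx// mulrA.
  have := infinite_centralizer Ca CB CM Cs.
  apply: contra_not; apply: sub_finite_set => x /= [Hx xa] y.
  by rewrite inE => /orP[/eqP->|/Hx].
have [s [szs us cs _]] := seq_ex m.+2.
have := @max_ring_poly_roots D ('X^(m.+1) - 'X) s.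
have szp : size ('X^(m.+1) - 'X : {poly D}) = m.+2.
  by rewrite size_polyDl ?size_polyXn// size_polyN size_polyX ltnS.
rewrite szp szs ltnn => H; suff: false by []; apply: H.
- by rewrite -size_poly_eq0 szp.
- apply/allP => x _; rewrite rootE hornerD hornerN hornerXn hornerX subr_eq0.
  have [->|x0] := eqVneq x 0; first by rewrite expr0n.
  by rewrite exprS D_exp// mulr1.
elim: s us cs {szs} => //= x s IH /andP[xs us] cs; rewrite IH//; last first.
  by move=> y z ys zs; apply: cs; rewrite inE ?ys ?zs orbT.
rewrite andbT; apply/allP => y ys; rewrite /diff_roots cs ?inE ?eqxx ?ys ?orbT//=.
by apply: D_unit; rewrite subr_eq0; apply: contraNneq xs => <-.
Qed.

End BoundedExponent.

(** * Nilpotent elements and the nil radical *)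

Section RngTheory.
Variable R : rngType.
Implicit Types x y z e f : R.

Lemma rngmul0 x : x ** 0 = 0.
Proof. by apply: (addrI (x ** 0)); rewrite -rngmulDr !addr0. Qed.

Lemma rng0mul x : 0 ** x = 0.
Proof. by apply: (addrI (0 ** x)); rewrite -rngmulDl !addr0. Qed.

Lemma rngmulN x y : x ** (- y) = - (x ** y).
Proof. by apply/eqP; rewrite -addr_eq0 -rngmulDr addNr rngmul0. Qed.

Lemma rngNmul x y : (- x) ** y = - (x ** y).
Proof. by apply/eqP; rewrite -addr_eq0 -rngmulDl addNr rng0mul. Qed.

Lemma rngmulBr x y z : x ** (y - z) = x ** y - x ** z.
Proof. by rewrite rngmulDr rngmulN. Qed.

Lemma rngmulBl x y z : (x - y) ** z = x ** z - y ** z.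
Proof. by rewrite rngmulDl rngNmul. Qed.

Lemma rngpowS x k : rngpow x k.+1 = x ** rngpow x k.
Proof. by []. Qed.

Lemma rngpowD x i j : rngpow x i ** rngpow x j = rngpow x (i + j).+1.
Proof. by elim: i => // i IH; rewrite rngpowS -rngmulA IH. Qed.

Lemma rngpowSr x k : rngpow x k.+1 = rngpow x k ** x.
Proof. by rewrite -[k in LHS]addn0 -rngpowD. Qed.

Lemma rngpow_mull x y k : exists s, rngpow (x ** y) k = s ** y.
Proof.
case: k => [|k]; first by exists x.
by exists (rngpow (x ** y) k ** x); rewrite rngpowSr rngmulA.
Qed.

Lemma rngpow_mulr x y k : exists s, rngpow (x ** y) k = x ** s.
Proof.
case: k => [|k]; first by exists y.
by exists (y ** rngpow (x ** y) k); rewrite rngpowS rngmulA.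
Qed.

Lemma rngpow_swap x y k : rngpow (y ** x) k.+1 = y ** rngpow (x ** y) k ** x.
Proof.
elim: k => [|k IH]; first by rewrite /rngpow /= !rngmulA.
by rewrite rngpowS IH rngpowS !rngmulA.
Qed.

Lemma rngpow_pow x i k : exists j, rngpow (rngpow x i) k = rngpow x j.
Proof.
elim: k => [|k [j IH]]; first by exists i.
by rewrite rngpowS IH rngpowD; eexists.
Qed.

Definition rng_nil x := exists k, rngpow x k = 0.

Lemma rng_nil0 : rng_nil 0.
Proof. by exists 0. Qed.

Lemma rng_nil_swap x y : rng_nil (x ** y) -> rng_nil (y ** x).
Proof. by move=> [k E]; exists k.+1; rewrite rngpow_swap E rngmul0 rng0mul. Qed.

Lemma rng_nil_pow x k : rng_nil (rngpow x k) -> rng_nil x.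
Proof. by move=> [l E]; have [j Ej] := rngpow_pow x k l; exists j; rewrite -Ej. Qed.

Lemma rng_nil_fixed x y : rng_nil x -> y = x ** y -> y = 0.
Proof.
move=> [k E] xy; suff -> : y = rngpow x k ** y by rewrite E rng0mul.
by elim: k {E} => // k IH; rewrite rngpowS -rngmulA -IH.
Qed.

(** As x^k = e x^k = s x^(k+1), the vanishing of a power of x passes down to x itself. *)
Lemma rng_nil_left_inverse e s x :
  rng_nil x -> e ** x = x -> e = s ** x -> e = 0.
Proof.
move=> [k E] ex es; suff x0 : x = 0 by rewrite es x0 rngmul0.
elim: k E => // k IH E; apply: IH.
have -> : rngpow x k = e ** rngpow x k.
  by case: k E => [|k] _; rewrite ?rngpowS ?rngmulA ex.
by rewrite es -rngmulA -rngpowS E rngmul0.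
Qed.

(** If y^(k+1) = 0, then x y^k = y^k, so y^k = 0 because x is nilpotent. Descending to y = 0 leaves
    x = e, a nilpotent idempotent. *)
Lemma idempotent_nil_diff e x y : e ** e = e -> e ** y = y ->
  x = e + y -> rng_nil x -> rng_nil y -> e = 0.
Proof.
move=> ee ey xE nx [k E]; suff y0 : y = 0.
  by apply: (rng_nil_fixed nx); rewrite xE y0 addr0 ee.
elim: k E => // k IH E; apply: IH; apply: (rng_nil_fixed nx).
rewrite xE rngmulDl -rngpowS E addr0.
by case: k E => [|k] _; rewrite ?rngpowS ?rngmulA ey.
Qed.

Lemma power_repeat_idempotent :
  (exists i j, (i < j)%N /\ forall x, rngpow x i = rngpow x j) ->
  exists m, forall x, rngpow x m ** rngpow x m = rngpow x m.
Proof.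
move=> [i [j [ij E]]]; pose d := (j - i)%N.
have d0 : (0 < d)%N by rewrite subn_gt0.
have jE : (i + d)%N = j by rewrite subnKC// ltnW.
have step c x : rngpow x (c + j) = rngpow x (c + i).
  by elim: c => [|c IH]; rewrite ?add0n ?E// !addSn !rngpowS IH.
have steps t c x : rngpow x (c + i + t * d) = rngpow x (c + i).
  elim: t c => [|t IH] c; first by rewrite addn0.
  by rewrite mulSn addnA -[(c + i + d)%N]addnA jE addnAC step addnAC IH.
(* The true exponent m + 1 is a multiple of the period d, and m >= i is in the periodic range, so
   squaring changes nothing. *)
pose m := (i.+1 * d).-1; exists m => x.
have mE : m.+1 = (i.+1 * d)%N by rewrite prednK// muln_gt0.
have im : (i <= m)%N by rewrite -ltnS mE leq_pmulr.
by rewrite rngpowD -addnS mE -(subnK im) steps.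
Qed.

(** The tails of the product ascend strictly: if t = s_j t' and also t' = r t, then t' = (r s_j) t'
    with r s_j nilpotent, so t' = 0. *)
Lemma starts_chain_prod (I : set R) (s : nat -> R) :
  (forall r x, I x -> I (r ** x)) -> (forall x, I x -> rng_nil x) ->
  forall k, (forall i, (i <= k)%N -> I (s i)) ->
  rngprod s k <> 0 -> exists b : R, starts_chain k b.
Proof.
move=> IM Inil.
pose tail := fix tail i k := if k is l.+1 then s i ** tail i.+1 l else s i.
have prod_tail k : rngprod s k = tail 0 k.
  have tailS i l : tail i l.+1 = tail i l ** s (i + l.+1)%N.
    elim: l i => [|l IH] i; first by rewrite /= addn1.
    by rewrite [LHS]/= -/(tail i.+1 l.+1) IH /= rngmulA addSnnS.
  by elim: k => // k IH; rewrite tailS -IH.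
move=> k Is; rewrite prod_tail => t0; exists (tail 0 k).
suff H j : tail j k <> 0 -> (forall i, (j <= i <= j + k)%N -> I (s i)) ->
  starts_chain k (tail j k) by apply: H => // i /andP[_ /Is].
elim: k {Is t0} j => // k IH j t0 Is; exists (tail j.+1 k).
have c0 : tail j.+1 k <> 0.
  by move=> E; apply: t0; rewrite -[LHS]/(s j ** tail j.+1 k) E rngmul0.
have sj : I (s j) by apply: Is; rewrite leqnn leq_addr.
split; last first.
  by apply: IH => // i /andP[ji ik]; apply: Is; rewrite ltnW//= addnS -addSn.
split; first by right; exists (s j).
move=> [E|[r E]]; apply: c0; first exact: rng_nil_fixed (Inil _ sj) E.
by apply: rng_nil_fixed (Inil _ (IM r _ sj)) _; rewrite -rngmulA.
Qed.

Definition nil_radical : set R := [set x | forall r, rng_nil (r ** x)].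

Lemma nil_radical_nil x : nil_radical x -> rng_nil x.
Proof. by move=> /(_ x) nx; apply: (@rng_nil_pow x 1). Qed.

Lemma nil_radical_mull r x : nil_radical x -> nil_radical (r ** x).
Proof. by move=> Jx s; rewrite rngmulA; exact: Jx. Qed.

Lemma nil_radical_mulr r x : nil_radical x -> nil_radical (x ** r).
Proof.
by move=> Jx s; rewrite rngmulA; apply: rng_nil_swap; rewrite rngmulA; exact: Jx.
Qed.

Lemma nil_radical_nilpotent :
  (exists N, forall b : R, ~ starts_chain N b) -> nilpotent_set nil_radical.
Proof.
move=> [N noN]; exists N => s Js; apply: contrapT.
move=> /(starts_chain_prod nil_radical_mull nil_radical_nil Js)[b].
exact: noN.
Qed.

(* An idempotent e = s(x - y) in R(x - y) would be a difference of the nilpotent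
   elements esxe and esye of eRe. *)
Lemma nil_radical_ideal :
  (exists m, forall x, rngpow x m ** rngpow x m = rngpow x m) ->
  two_sided_ideal nil_radical.
Proof.
move=> [m mP]; split.
- by move=> r; rewrite rngmul0; exact: rng_nil0.
- move=> x y Jx Jy r; exists m; set e := rngpow _ m.
  have ee : e ** e = e by exact: mP.
  have [s es] := rngpow_mull r (x - y) m; rewrite -/e in es.
  have nile z : nil_radical z -> rng_nil (e ** (s ** z) ** e).
    by move=> Jz; apply: rng_nil_swap; rewrite !rngmulA; exact: Jz.
  apply: (@idempotent_nil_diff e (e ** (s ** x) ** e) (e ** (s ** y) ** e)) => //.
  + by rewrite !rngmulA ee.
  + apply/eqP; rewrite -subr_eq -rngmulBl -rngmulBr -rngmulBr -es ee ee.
    by [].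
  + exact: nile.
  + exact: nile.
- by move=> r x Jx; split; [exact: nil_radical_mull|exact: nil_radical_mulr].
Qed.

Lemma maximal_left_mult (P : R -> Prop) (b0 : R) :
  (exists N, forall b : R, ~ starts_chain N b) -> P b0 ->
  exists2 b, P b & forall c, P c -> ~ left_smult b c.
Proof.
move=> [N noN] Pb0; apply: contrapT => /forall2NP nomax; apply: (noN b0).
elim: N b0 Pb0 {noN} => //= k IH b Pb.
have [//|/existsNP[c /not_implyP[Pc /contrapT bc]]] := nomax b.
by exists c; split=> //; exact: IH.
Qed.

(** Here a chain is prolonged at its lower end, which is why the element that starts it varies. *)
Lemma minimal_left_mult (P : R -> Prop) (b0 : R) :
  (exists N, forall b : R, ~ starts_chain N b) -> P b0 ->
  exists2 b, P b & forall c, P c -> ~ left_smult c b.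
Proof.
move=> [N noN] Pb0; apply: contrapT => /forall2NP nomin.
suff [b _ Nb] : exists2 b, P b & starts_chain N b by exact: noN Nb.
elim: N {noN} => [|k [b Pb kb]]; first by exists b0.
have [//|/existsNP[c /not_implyP[Pc /contrapT bc]]] := nomin b.
by exists c => //=; exists b.
Qed.

End RngTheory.

(** * Corner rings *)

(** For idempotents f and e this is the Peirce component fQe. *)
Definition corner_set (Q : rngType) (f e : Q) : set Q :=
  [set x | f ** x = x /\ x ** e = x].

Section Corner.
Variables (Q : rngType) (f : Q) (m : nat).
Hypothesis ff : f ** f = f.
Hypothesis f_neq0 : f != 0.
Hypothesis f_exp : forall x, corner_set f f x -> x != 0 -> rngpow x m = f.

Let corner_pred : {pred Q} := [pred x | (f ** x == x) && (x ** f == x)].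

Let corner_predP x : reflect (corner_set f f x) (x \in corner_pred).
Proof.
by apply: (iffP andP) => [[/eqP ? /eqP ?]|[? ?]]; split=> //; apply/eqP.
Qed.

Let corner_zmod_closed : zmod_closed corner_pred.
Proof.
split=> [|x y /corner_predP[fx xf] /corner_predP[fy yf]]; apply/corner_predP.
  by split; rewrite ?rngmul0 ?rng0mul.
by split; rewrite ?rngmulBr ?rngmulBl ?fx ?fy ?xf ?yf.
Qed.
HB.instance Definition _ := GRing.isZmodClosed.Build Q corner_pred corner_zmod_closed.

(** The ring fQf with unit f becomes a type of its own, to which [finite_of_bounded_exponent]
    applies. *)
Record corner := Corner { corner_val : Q; _ : corner_val \in corner_pred }.
HB.instance Definition _ := [isSub for corner_val].
HB.instance Definition _ := [Choice of corner by <:].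
HB.instance Definition _ := [SubChoice_isSubZmodule of corner by <:].

Let cornerP (x : corner) : f ** val x = val x /\ val x ** f = val x.
Proof. exact/corner_predP/valP. Qed.

Let corner_one : corner := Corner (introT (corner_predP f) (conj ff ff)).

Let corner_mul_subproof (x y : corner) : val x ** val y \in corner_pred.
Proof.
apply/corner_predP; split; first by rewrite rngmulA (cornerP x).1.
by rewrite -rngmulA (cornerP y).2.
Qed.
Let corner_mul (x y : corner) : corner := Corner (corner_mul_subproof x y).

Let corner_mulA : associative corner_mul.
Proof. by move=> x y z; apply: val_inj; exact: rngmulA. Qed.
Let corner_mul1 : left_id corner_one corner_mul.
Proof. by move=> x; apply: val_inj; exact: (cornerP x).1. Qed.
Let corner_mulr1 : right_id corner_one corner_mul.
Proof. by move=> x; apply: val_inj; exact: (cornerP x).2. Qed.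
Let corner_mulDl : left_distributive corner_mul +%R.
Proof. by move=> x y z; apply: val_inj; exact: rngmulDl. Qed.
Let corner_mulDr : right_distributive corner_mul +%R.
Proof. by move=> x y z; apply: val_inj; exact: rngmulDr. Qed.
Let corner_one_neq0 : corner_one != 0.
Proof. by rewrite -(inj_eq val_inj). Qed.
HB.instance Definition _ := GRing.Zmodule_isNzRing.Build corner
  corner_mulA corner_mul1 corner_mulr1 corner_mulDl corner_mulDr corner_one_neq0.

Lemma val_cornerX (x : corner) k : val (x ^+ k.+1) = rngpow (val x) k.
Proof. by elim: k => // k IH; rewrite exprS rngpowS -IH. Qed.

Lemma corner_exp (x : corner) : x != 0 -> x ^+ m.+1 = 1.
Proof.
by move=> x0; apply: val_inj; rewrite val_cornerX f_exp.
Qed.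

Let corner_unit : {pred corner} := [pred x | x != 0].
Let corner_inv (x : corner) := if x == 0 then x else x ^+ m.

Let corner_mulVr : {in corner_unit, left_inverse 1 corner_inv *%R}.
Proof. by move=> x x0; rewrite /corner_inv ifN// -exprSr corner_exp. Qed.
Let corner_mulrV : {in corner_unit, right_inverse 1 corner_inv *%R}.
Proof. by move=> x x0; rewrite /corner_inv ifN// -exprS corner_exp. Qed.
Let corner_unitP (x y : corner) : y * x = 1 /\ x * y = 1 -> corner_unit x.
Proof.
by move=> [yx _]; apply: contra_eq_neq yx => ->; rewrite mulr0 eq_sym oner_eq0.
Qed.
Let corner_inv_out : {in [predC corner_unit], corner_inv =1 id}.
Proof. by move=> x; rewrite inE negbK => /eqP ->; rewrite /corner_inv eqxx. Qed.
HB.instance Definition _ := GRing.NzRing_hasMulInverse.Build corner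
  corner_mulVr corner_mulrV corner_unitP corner_inv_out.

Lemma finite_corner_set : finite_set (corner_set f f).
Proof.
have fin := finite_of_bounded_exponent (ltn0Sn m) corner_exp.
apply: sub_finite_set (finite_image (val : corner -> Q) fin) => x /corner_predP Hx.
by exists (Corner Hx).
Qed.

End Corner.

(** * Radical-free rings are finite *)

Section Semisimple.
Variables (Q : rngType) (m : nat).
Hypothesis power_idem : forall x : Q, rngpow x m ** rngpow x m = rngpow x m.
Hypothesis chains : exists N, forall b : Q, ~ starts_chain N b.
Hypothesis radical0 : forall x : Q, nil_radical x -> x = 0.
Implicit Types e f x y z : Q.

(* For a maximal idempotent e, the elements x - xe generate a nil left ideal: an
   idempotent f of it has fe = 0, and e + f - ef would be larger than e. *)
Lemma has_unit : exists u : Q, forall x, u ** x = x /\ x ** u = x.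
Proof.
have [e ee e_max] := @maximal_left_mult Q (fun e => e ** e = e) 0 chains (rngmul0 0).
have er x : x ** e = x.
  apply/esym/subr0_eq/radical0 => r; rewrite rngmulBr rngmulA.
  set y := r ** x; set z := y - y ** e; exists m; set f := rngpow z m.
  have ff : f ** f = f by exact: power_idem.
  have ze : z ** e = 0 by rewrite rngmulBl -rngmulA ee subrr.
  have fe : f ** e = 0.
    by rewrite /f; case: (m) => [|k] //; rewrite rngpowSr -rngmulA ze rngmul0.
  pose g := e + f - e ** f.
  have eg : e ** g = e by rewrite rngmulBr rngmulDr rngmulA ee addrK.
  have fg : f ** g = f by rewrite rngmulBr rngmulDr rngmulA fe ff rng0mul add0r subr0.
  have gg : g ** g = g.
    by rewrite {1}/g rngmulBl rngmulDl eg fg -rngmulA fg.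
  have ge : g ** e = e by rewrite rngmulBl rngmulDl -rngmulA fe ee rngmul0 addr0 subr0.
  have gE : g = e.
    have eg' : left_mult e g by right; exists e.
    have [ge'|[r' ge']] : left_mult g e.
    - by apply: contrapT => nge; apply: (e_max g gg).
    - by [].
    - by rewrite -ge [in RHS]ge' -rngmulA ee.
  (* Together with fe = 0 this gives f = ff = f(ef) = 0. *)
  have fE : f = e ** f.
    by apply/eqP; rewrite -subr_eq0 -(inj_eq (addrI e)) addr0 addrA -/g gE.
  by rewrite -ff {2}fE rngmulA fe rng0mul.
(* Since e is a right unit, every r annihilates x - ex from the left. *)
exists e => x; split=> //; apply/esym/subr0_eq/radical0 => r.
by rewrite rngmulBr rngmulA er subrr; exact: rng_nil0.
Qed.

Definition primitive_idempotent f := [/\ f ** f = f, f != 0 &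
  forall g, g ** g = g -> f ** g = g -> g ** f = g -> g = 0 \/ g = f].

(** The power [rngpow x m] is an idempotent of fQf, hence 0 or f. *)
Lemma corner_nil_or_unit f x : primitive_idempotent f -> corner_set f f x ->
  rng_nil x \/ rngpow x m = f.
Proof.
move=> [ff _ fP] [fx xf].
have [] := fP (rngpow x m) (power_idem x).
- by case: (m) => [|k] //; rewrite rngpowS rngmulA fx.
- by case: (m) => [|k] //; rewrite rngpowSr -rngmulA xf.
- by left; exists m.
- by right.
Qed.

(** A nilpotent x in fQf would lie in the radical. Indeed rx is nilpotent if frfx is, and otherwise
    a power of frfx is f, which gives x a left inverse in spite of its nilpotency. *)
Lemma corner_division f x : primitive_idempotent f -> corner_set f f x -> x != 0 ->
  rngpow x m = f.
Proof.
move=> pf Sx x0; have [nx|//] := corner_nil_or_unit pf Sx.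
case: (pf) (Sx) => ff f0 _ [fx xf].
case/eqP: x0; apply: radical0 => r; rewrite -xf rngmulA; apply: rng_nil_swap.
rewrite -fx 2!rngmulA -rngmulA.
have Sy : corner_set f f (f ** r ** f ** x).
  by split; rewrite ?rngmulA ?ff// -rngmulA xf.
have [|E] := corner_nil_or_unit pf Sy; first by rewrite !rngmulA.
have [s sE] := rngpow_mull (f ** r ** f) x m.
by case/eqP: f0; apply: (rng_nil_left_inverse (s := s) nx fx); rewrite -sE.
Qed.

(** Peirce decomposition x = xf + x(e - f). *)
Lemma finite_corner_split_right g e f : f ** f = f -> e ** f = f -> f ** e = f ->
  e ** e = e -> finite_set (corner_set g f) -> finite_set (corner_set g (e - f)) ->
  finite_set (corner_set g e).
Proof.
move=> ff ef fe ee fin1 fin2.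
apply: sub_finite_set (finite_image2 (fun x y => x + y) fin1 fin2) => x [gx xe].
exists (x ** f); first by split; rewrite ?rngmulA ?gx// -rngmulA ff.
exists (x ** (e - f)); last by rewrite -rngmulDr addrC subrK.
split; first by rewrite rngmulA gx.
by rewrite -rngmulA rngmulBl !rngmulBr ee ef fe ff subrr subr0.
Qed.

Lemma finite_corner_split_left e g f : f ** f = f -> e ** f = f -> f ** e = f ->
  e ** e = e -> finite_set (corner_set f g) -> finite_set (corner_set (e - f) g) ->
  finite_set (corner_set e g).
Proof.
move=> ff ef fe ee fin1 fin2.
apply: sub_finite_set (finite_image2 (fun x y => x + y) fin1 fin2) => x [ex xg].
exists (f ** x); first by split; rewrite ?rngmulA ?ff// -rngmulA xg.
exists ((e - f) ** x); last by rewrite -rngmulDl addrC subrK.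
split; last by rewrite -rngmulA xg.
by rewrite rngmulA rngmulBl !rngmulBr ee ef fe ff subrr subr0.
Qed.

(** Take e minimal among the idempotents with S e infinite. An idempotent f of eQe other than 0 and
    e would put f and e - f strictly below e, so S f and S (e - f), and with them S e, would be
    finite. S stands for either side of a Peirce component. *)
Lemma minimal_infinite_primitive (S : Q -> set Q) (u : Q) :
  u ** u = u -> infinite_set (S u) -> finite_set (S 0) ->
  (forall e f, f ** f = f -> e ** f = f -> f ** e = f -> e ** e = e ->
    finite_set (S f) -> finite_set (S (e - f)) -> finite_set (S e)) ->
  exists2 e, primitive_idempotent e & infinite_set (S e).
Proof.
move=> uu Su S0 S_split.
have [e [ee Se] e_min] := @minimal_left_mult Q
  (fun e => e ** e = e /\ infinite_set (S e)) u chains (conj uu Su).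
exists e => //; split=> //.
  by apply/eqP => e0; apply: Se; rewrite e0.
have small f : f ** f = f -> e ** f = f -> f ** e = f -> f <> e -> finite_set (S f).
  move=> ff ef fe nfe; apply: contrapT => Sf; apply: (e_min f (conj ff Sf)).
  split; first by right; exists f.
  move=> [E|[r E]]; apply: nfe; first by [].
  by rewrite -ef [in LHS]E -rngmulA ff.
move=> f ff ef fe; apply: contrapT => /not_orP[f0 nfe]; apply: Se.
apply: (S_split e f) => //; first exact: small.
apply: small.
- by rewrite rngmulBl !rngmulBr ee ef fe ff subrr subr0.
- by rewrite rngmulBr ee ef.
- by rewrite rngmulBl ee fe.
- by move=> /eqP; rewrite subr_eq addrC -subr_eq subrr => /eqP/esym.
Qed.

Lemma semisimple_finite : finite_set [set: Q].
Proof.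
apply: contrapT => Q_inf; have [u uP] := has_unit.
have uu : u ** u = u := (uP u).1.
have corner0r g : finite_set (corner_set g (0 : Q)).
  by apply: sub_finite_set (finite_set1 0) => x [_ <-]; rewrite rngmul0.
have corner0l g : finite_set (corner_set (0 : Q) g).
  by apply: sub_finite_set (finite_set1 0) => x [<- _]; rewrite rng0mul.
have [e pe Se] : exists2 e, primitive_idempotent e & infinite_set (corner_set u e).
  apply: (@minimal_infinite_primitive (corner_set u) u) => //.
  - by apply: contra_not Q_inf; apply: sub_finite_set => x _; exact: uP.
  - by move=> e f; exact: finite_corner_split_right.
have [f pf Sf] : exists2 f, primitive_idempotent f & infinite_set (corner_set f e).
  apply: (@minimal_infinite_primitive (fun f => corner_set f e) u) => //.
  by move=> g f; exact: finite_corner_split_left.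
have [x [[fx xe] /eqP x0]] : (corner_set f e `\` [set 0]) !=set0.
  by apply: infinite_setN0; apply: infinite_setD => //; exact: finite_set1.
have [r nrx] : exists r, ~ rng_nil (r ** x).
  by apply/existsNP => /radical0; exact/eqP.
case: (pe) (pf) => ee _ _ [ff f0 _].
(* The element yx = erx of eQe is not nilpotent, since rx is not; so a power of it is e, of the form
   yt. Then z = (zy)t for z in fQe, with zy in the finite ring fQf. *)
pose y := e ** r ** f.
have Syx : corner_set e e (y ** x).
  by split; rewrite -?rngmulA ?xe// !rngmulA ee.
have yx : rngpow (y ** x) m = e.
  have [|//] := corner_nil_or_unit pe Syx.
  rewrite /y -!rngmulA fx => /rng_nil_swap; rewrite -rngmulA xe.
  by move/nrx.
apply: Sf.
have fin := finite_corner_set ff f0 (fun z Sz => corner_division pf Sz).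
have [t tE] := rngpow_mulr y x m.
apply: sub_finite_set (finite_image (fun z => z ** t) fin) => z [fz ze].
exists (z ** y); last by rewrite -rngmulA -tE yx ze.
by split; [rewrite rngmulA fz|rewrite /y -!rngmulA ff].
Qed.

End Semisimple.

(** * Quotients *)

Section QuotientRng.
Local Open Scope quotient_scope.
Variables (R : rngType) (J : set R).
Hypothesis J_ideal : two_sided_ideal J.

Let ideal_pred : {pred R} := [pred x | `[< J x >]].

Let ideal_zmod_closed : zmod_closed ideal_pred.
Proof.
case: J_ideal => J0 JB _; split=> [|x y /asboolP Jx /asboolP Jy]; apply/asboolP => //.
exact: JB.
Qed.
HB.instance Definition _ := GRing.isZmodClosed.Build R ideal_pred ideal_zmod_closed.

Definition rng_quot := Quotient.quot ideal_pred.
HB.instance Definition _ := GRing.Zmodule.on rng_quot.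
HB.instance Definition _ := EqQuotient.on rng_quot.

Definition rng_proj (x : R) : rng_quot := \pi_rng_quot x.

Lemma rng_projP x y : rng_proj x = rng_proj y <-> J (x - y).
Proof.
rewrite /rng_proj; split=> [/eqP|Jxy].
  by rewrite -(Quotient.idealrBE ideal_pred) => /asboolP.
by apply/eqP; rewrite -(Quotient.idealrBE ideal_pred); exact/asboolP.
Qed.

Lemma rng_proj_surj (q : rng_quot) : exists x, rng_proj x = q.
Proof. by exists (repr q); exact: reprK. Qed.

Lemma rng_projD x y : rng_proj (x + y) = rng_proj x + rng_proj y.
Proof. exact: (raddfD (\pi_(Quotient.quot ideal_pred))). Qed.

Let quot_mul (p q : rng_quot) := rng_proj (repr p ** repr q).

Let quot_mulE x y : quot_mul (rng_proj x) (rng_proj y) = rng_proj (x ** y).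
Proof.
apply/rng_projP; case: J_ideal => J0 JB JM.
have Jr z : J (z - repr (rng_proj z)) by apply/rng_projP; rewrite [RHS]reprK.
(* With x' and y' the chosen representatives, xy - x'y' = (x - x')y + x'(y - y'). *)
have [Jx _] := (JM (repr (rng_proj x)) _ (Jr y)).
have [_ Jy] := (JM y _ (Jr x)).
rewrite rngmulBl in Jy; rewrite rngmulBr in Jx.
have := JB _ _ J0 Jy; rewrite sub0r opprB => /JB /(_ Jx).
by rewrite opprB addrC addrA subrK.
Qed.

Let quot_mulA : associative quot_mul.
Proof.
move=> p q r; have [x <-] := rng_proj_surj p.
have [[y <-] [z <-]] := (rng_proj_surj q, rng_proj_surj r).
by rewrite !quot_mulE rngmulA.
Qed.
Let quot_mulDl : left_distributive quot_mul +%R.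
Proof.
move=> p q r; have [x <-] := rng_proj_surj p.
have [[y <-] [z <-]] := (rng_proj_surj q, rng_proj_surj r).
by rewrite -rng_projD !quot_mulE rngmulDl rng_projD.
Qed.
Let quot_mulDr : right_distributive quot_mul +%R.
Proof.
move=> p q r; have [x <-] := rng_proj_surj p.
have [[y <-] [z <-]] := (rng_proj_surj q, rng_proj_surj r).
by rewrite -rng_projD !quot_mulE rngmulDr rng_projD.
Qed.
HB.instance Definition _ := Zmodule_isRng.Build rng_quot quot_mulA quot_mulDl quot_mulDr.

Lemma rng_projM x y : rng_proj (x ** y) = rng_proj x ** rng_proj y.
Proof. by rewrite -quot_mulE. Qed.

Lemma finite_index_quot : finite_set [set: rng_quot] -> finite_index J.
Proof.
move=> fin; apply: sub_finite_set
  (finite_image (fun q : rng_quot => [set y | rng_proj y = q]) fin) => _ [x _ <-].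
exists (rng_proj x) => //; apply/seteqP.
by split=> y /=; [exact: (rng_projP _ _).1|exact: (rng_projP _ _).2].
Qed.

End QuotientRng.

(** * Lifting chains along surjective morphisms *)

Section SurjectiveMorphism.
Variables (R Q : rngType) (f : R -> Q).
Hypothesis f_mul : forall x y, f (x ** y) = f x ** f y.
Hypothesis f_surj : forall q, exists x, f x = q.

Lemma morphism_rngpow x k : f (rngpow x k) = rngpow (f x) k.
Proof. by elim: k => // k IH; rewrite !rngpowS f_mul IH. Qed.

(** Lifting begins at the upper end, so that the lift of q = r q' can be chosen as a multiple of the
    lift of q'. Strictness holds because f preserves [left_mult]. *)
Lemma starts_chain_lift k (q : Q) : starts_chain k q ->
  exists2 b : R, f b = q & starts_chain k b.
Proof.
elim: k q => [|k IH] q /=; first by have [b <-] := f_surj q; exists b.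
move=> [q' [[qq' nqq'] /IH[b' fb' kb']]].
case: qq' => [E|[r E]]; first by case: nqq'; left.
have [s fs] := f_surj r; exists (s ** b'); first by rewrite f_mul fs fb'.
exists b'; split=> //; split; first by right; exists s.
move=> [E'|[t E']]; apply: nqq'.
  by left; rewrite -fb' E' f_mul fs fb'.
by right; exists (f t); rewrite -fb' {1}E' !f_mul fs fb' E.
Qed.

End SurjectiveMorphism.

(** * The algebraic theorem and the conclusion *)

Theorem nilpotent_by_finite_of_bounds (R : rngType) :
  (exists i j, (i < j)%N /\ forall x : R, rngpow x i = rngpow x j) ->
  (exists N, forall b : R, ~ starts_chain N b) -> nilpotent_by_finite R.
Proof.
move=> /power_repeat_idempotent[m mP] chains.
have J_ideal : two_sided_ideal (@nil_radical R) by apply: nil_radical_ideal; exists m.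
exists (@nil_radical R); split=> //; last exact: nil_radical_nilpotent.
apply: (finite_index_quot (J_ideal := J_ideal)).
pose pr := rng_proj J_ideal.
have prM : forall x y, pr (x ** y) = pr x ** pr y := rng_projM J_ideal.
have prX := morphism_rngpow prM.
have pr0 : pr 0 = 0 by apply: (addrI (pr 0)); rewrite -rng_projD !addr0.
apply: (@semisimple_finite _ m).
- by move=> q; have [x <-] := rng_proj_surj q; rewrite -prX -prM mP.
- case: chains => N noN; exists N => q.
  by move=> /(starts_chain_lift prM (@rng_proj_surj _ _ J_ideal))[b _ /noN].
(* The quotient has zero radical: if the class of x is in it, then each rx has a power in J. This
   power is nilpotent, hence so is rx, and x is in J. *)
move=> q; have [x <-] := rng_proj_surj q => Jq.
rewrite -pr0; apply/rng_projP; rewrite subr0 => r.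
have [k E] := Jq (pr r); apply: (@rng_nil_pow _ _ k); apply: nil_radical_nil.
rewrite -[rngpow _ _]subr0; apply/(rng_projP J_ideal).
by rewrite -[rng_proj _ _]/(pr _) prX prM -/pr E -pr0.
Qed.

Theorem theorem4p1 (R : rngType)
    (omega_cat : omega_categorical (ring_structure R))
    (nsop : ~ strict_order_property (complete_theory (ring_structure R))) :
  nilpotent_by_finite R.
Proof.
apply: nilpotent_by_finite_of_bounds; first exact: uniform_power_repeat.
exact: bounded_chains.
Qed.
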